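(* Suppose that $f_{n+1}<4p_n$ for all $n\geq 1$. Then every even number $x>2$ can be written as a sum $x=p+q$ of prime numbers $p\leq q$ with $\frac x4<p\leq\frac x2$. In particular, for each $n\geq 1$ one has $4p_n=p+q$ for some primes $p,q$ with $p_{n+1}\leq p\leq q$, which implies Bertrand's postulate ($p_{n+1}<2p_n$ for all $n\ge1$).
   Context: Let $p_1=2,p_2=3,p_3=5,\ldots$ be the prime numbers in increasing order. For $n\ge1$ let $S_n\subseteq\mathbb{N}$ be the numerical semigroup generated by all primes not less than $p_n$ (i.e. the set of all finite sums, including the empty sum $0$, of primes $\ge p_n$); its complement in $\mathbb{N}$ is finite. The Frobenius number $f_n$ of $S_n$ is the largest integer not contained in $S_n$. *)

(* Defs.v *)
From mathcomp Require Import all_boot.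
From mathcomp Require Import zify.

Set Implicit Arguments.
Unset Strict Implicit.
Unset Printing Implicit Defensive.

Definition next_prime (m : nat) : nat :=
  ex_minn (P := fun q => (m < q) && prime q)
    (let: exist2 q lt_mq pr_q := prime_above m in
     ex_intro _ q (introT andP (conj lt_mq pr_q))).

(* Indexing starts at 1: [nth_prime 1 = 2], [nth_prime 2 = 3], ...; the value
   at 0 is a dummy (equal to [nth_prime 1]). *)
Definition nth_prime (n : nat) : nat := iter n.-1 next_prime 2.

(* The submonoid of (nat, +) generated by [A]; [s = [::]] gives 0. *)
Definition generated (A : pred nat) (x : nat) : Prop :=
  exists2 s : seq nat, all A s & x = sumn s.

Definition prime_semigroup (n : nat) : nat -> Prop :=
  generated (fun q => prime q && (nth_prime n <= q)).

(* Restricting to natural numbers loses nothing when some natural number is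
   missing from [T], as is the case for [prime_semigroup n], which omits 1. *)
Definition is_frobenius_number (T : nat -> Prop) (f : nat) : Prop :=
  ~ T f /\ forall m, ~ T m -> m <= f.

Lemma next_primeP m :
  [/\ m < next_prime m, prime (next_prime m) &
      forall q, m < q -> prime q -> next_prime m <= q].
Proof.
rewrite /next_prime; case: ex_minnP => q /andP[lt_mq pr_q] min_q.
by split=> // r lt_mr pr_r; apply: min_q; rewrite lt_mr.
Qed.

Lemma nth_prime_prime n : prime (nth_prime n).
Proof.
by rewrite /nth_prime; case: n.-1 => [|k] //=; case: (next_primeP (iter k next_prime 2)).
Qed.

Lemma generated_dec (A : pred nat) (x : nat) : decidable (generated A x).
Proof.
elim/ltn_ind: x => -[|x] IH; first by left; exists [::].
have decP (i : 'I_x.+1) : decidable (A (x.+1 - i) /\ generated A i).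
  case: (boolP (A (x.+1 - i))) => Ai; last by right; case.
  by case: (IH i (ltn_ord i)) => Hi; [left | right; case].
case: (pickP (fun i => decP i : bool)) => [i|none].
  by case: (decP i) => //= H _; left; case: H => Ai [s As Es];
     exists ((x.+1 - i) :: s); rewrite /= ?Ai ?As // -Es subnK // ltnW.
right=> -[s].
elim: s => [|a s IHs] //= /andP[Aa As] Ex.
case: a => [|a] in Aa Ex *; first exact: IHs.
have lt_s : sumn s < x.+1 by lia.
have := none (Ordinal lt_s); case: (decP _) => //= -[]; split; last by exists s.
by rewrite (_ : x.+1 - sumn s = a.+1) //; lia.
Qed.

Lemma generated_coprime (A : pred nat) a b m :
  A a -> A b -> 0 < a -> coprime a b -> 0 < b -> a * b <= m -> generated A m.
Proof.
move=> Aa Ab a_gt0 co_ab b_gt0 le_abm.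
have [u v Euv _] := egcdnP b a_gt0.
pose k := (m * u) %% b.
have Ek : k * a = m %[mod b].
  rewrite /k modnMml -mulnA Euv (eqP co_ab) mulnDr muln1 mulnA.
  by rewrite modnMDl.
have le_kam : k * a <= m.
  by apply: leq_trans le_abm; rewrite mulnC leq_mul2l ltnW ?orbT // ltn_mod.
have /dvdnP[l El] : b %| m - k * a by rewrite -eqn_mod_dvd // Ek.
exists (nseq k a ++ nseq l b); first by rewrite all_cat !all_nseq Aa Ab !orbT.
by rewrite sumn_cat !sumn_nseq mulnC; lia.
Qed.

Lemma prime_semigroup1 n : ~ prime_semigroup n 1.
Proof.
case=> -[|a s] //= /andP[/andP[/prime_gt1 a_gt1 _] _]; lia.
Qed.

Lemma frobenius_number_exists n :
  {f : nat | is_frobenius_number (prime_semigroup n) f}.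
Proof.
pose P x := ~~ (generated_dec (fun q => prime q && (nth_prime n <= q)) x : bool).
have PE x : reflect (~ prime_semigroup n x) (P x).
  by rewrite /P; case: generated_dec => H /=; constructor; [apply | ].
have exP : exists x, P x by exists 1; apply/PE; apply: prime_semigroup1.
pose a := nth_prime n; pose b := next_prime a.
have pr_a : prime a := nth_prime_prime n.
have [lt_ab pr_b _] := next_primeP a.
have ubP x : P x -> x <= a * b.
  move/PE => nSx; rewrite leqNgt; apply/negP => /ltnW le_abx; apply: nSx.
  apply: (generated_coprime (a := a) (b := b)) => //=; rewrite ?prime_gt0 //.
  - by rewrite pr_a leqnn.
  - by rewrite pr_b ltnW.
  - rewrite prime_coprime // dvdn_prime2 //; lia.
case: (ex_maxnP exP ubP) => f /PE nSf maxf; exists f; split=> // m /PE; exact: maxf.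
Qed.

Definition frobenius_number (n : nat) : nat := sval (frobenius_number_exists n).

(* Main.v *)
Require Import Defs.
From mathcomp Require Import all_boot.
From mathcomp Require Import zify.

(** Choose [n] with [4 p_n <= x < 4 p_(n+1)]. Then [x] exceeds [f_(n+1)], so it
    is a sum of primes [>= p_(n+1) > x / 4]. There are fewer than four of them,
    and they are odd, so for even [x > 0] there are exactly two. *)

Lemma nth_primeS n : 0 < n -> nth_prime n.+1 = next_prime (nth_prime n).
Proof. by case: n. Qed.

Lemma nth_prime_ltS {n} : 0 < n -> nth_prime n < nth_prime n.+1.
Proof. by move=> n_gt0; rewrite nth_primeS //; case: (next_primeP (nth_prime n)). Qed.

Lemma nth_prime_gt n : n < nth_prime n.
Proof.
elim: n => [|[|n] IHn] //.
by have := @nth_prime_ltS n.+1 isT; lia.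
Qed.

Lemma prime_semigroup_gt_frobenius {n x} :
  frobenius_number n < x -> prime_semigroup n x.
Proof.
rewrite /frobenius_number; case: frobenius_number_exists => f [_ max_f] /= lt_fx.
(* A Frobenius number only bounds the non-members, so membership has to come from deciding it. *)
case: (generated_dec (fun q => prime q && (nth_prime n <= q)) x) => // /max_f.
by rewrite leqNgt lt_fx.
Qed.

Lemma even_prime_semigroup_two_primes m x :
    2 < nth_prime m -> prime_semigroup m x -> ~~ odd x ->
    0 < x < 4 * nth_prime m ->
  exists p q, [/\ prime p, prime q, nth_prime m <= p, p <= q & x = p + q].
Proof.
move=> gt2 [s As ->].
have oddP q : prime q -> nth_prime m <= q -> odd q.
  by move=> pr_q le_q; have [q2|//] := even_prime pr_q; lia.
(* Split on the number of summands: none contradicts [0 < x], one or three odd summands have an odd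
   sum, and four or more reach [4 * nth_prime m]. *)
case: s As => [|a [|b [|c [|d s]]]] //=; rewrite ?andbT.
- by case/andP=> /oddP oa /oa; lia.
- case/andP=> /andP[pr_a le_a] /andP[pr_b le_b] _ _.
  case: (leqP a b) => [le_ab | /ltnW le_ba].
  + by exists a, b; split=> //; lia.
  + by exists b, a; split=> //; lia.
- case/and3P=> /andP[/oddP oa /oa odd_a] /andP[/oddP ob /ob odd_b].
  by case/andP=> /oddP oc /oc odd_c; lia.
- by case/and5P=> /andP[_ ?] /andP[_ ?] /andP[_ ?] /andP[_ ?] _; lia.
Qed.

(** Take the largest [n] with [4 * nth_prime n <= x]. The bound 8 is four times the first prime, so
    such an [n] exists, and [nth_prime_gt] bounds it. *)
Lemma nth_prime_bracket x :
  8 <= x -> exists2 n, 0 < n & 4 * nth_prime n <= x < 4 * nth_prime n.+1.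
Proof.
move=> x_ge8; pose P n := (0 < n) && (4 * nth_prime n <= x).
have exP : exists n, P n by exists 1.
have ubP n : P n -> n <= x by case/andP=> _; have := nth_prime_gt n; lia.
case: (ex_maxnP exP ubP) => n /andP[n_gt0 le_nx] max_n.
exists n => //; rewrite le_nx ltnNge; apply/negP => le_x.
by have := max_n n.+1; rewrite /P le_x ltnn => /(_ isT).
Qed.

Theorem proposition3 :
  (forall n : nat, 1 <= n -> frobenius_number n.+1 < 4 * nth_prime n) ->
  [/\ forall x : nat, ~~ odd x -> 2 < x ->
        exists p q : nat,
          [/\ prime p, prime q, p <= q, x = p + q & (x < 4 * p) && (2 * p <= x)],
      forall n : nat, 1 <= n ->
        exists p q : nat,
          [/\ prime p, prime q, nth_prime n.+1 <= p, p <= q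
            & 4 * nth_prime n = p + q]
    & forall n : nat, 1 <= n -> nth_prime n.+1 < 2 * nth_prime n].
Proof.
move=> frob_lt.
have two_primes n x : 0 < n -> ~~ odd x ->
    4 * nth_prime n <= x < 4 * nth_prime n.+1 ->
  exists p q, [/\ prime p, prime q, nth_prime n.+1 <= p, p <= q & x = p + q].
  move=> n_gt0 even_x /andP[le_x lt_x].
  (* As p_(n+1) > p_n >= 2, every generator of the semigroup is odd. *)
  have := prime_gt1 (nth_prime_prime n); have := nth_prime_ltS n_gt0.
  move=> ltS gt1; apply: even_prime_semigroup_two_primes => //; try lia.
  exact: prime_semigroup_gt_frobenius (leq_trans (frob_lt n n_gt0) le_x).
(* Here x is the left end of its bracket. *)
have four_primes n : 1 <= n -> exists p q : nat,
    [/\ prime p, prime q, nth_prime n.+1 <= p, p <= q & 4 * nth_prime n = p + q].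
  move=> n_gt0; apply: two_primes => //; first by rewrite oddM.
  by rewrite leqnn ltn_pmul2l // nth_prime_ltS.
split=> // [x even_x x_gt2 | n n_gt0].
- have [x_ge8 | x_lt8] := leqP 8 x.
    have [n n_gt0 xn] := nth_prime_bracket _ x_ge8.
    have [p [q [pr_p pr_q le_p le_pq Ex]]] := two_primes n x n_gt0 even_x xn.
    by exists p, q; split=> //; lia.
  (* The even numbers below the first bracket: 4 = 2 + 2 and 6 = 3 + 3. *)
  have [->|->] : x = 4 \/ x = 6 by lia.
    by exists 2, 2.
  by exists 3, 3.
- have [p [q [_ _ le_p le_pq E]]] := four_primes n n_gt0.
  (* From 4 p_n = p + q >= 2 p_(n+1) only the weak inequality follows. Equality would make p_n
     divide the larger prime p_(n+1). *)
  rewrite ltn_neqAle; apply/andP; split; last by lia.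
  apply/eqP => E2.
  have: nth_prime n %| nth_prime n.+1 by rewrite E2 dvdn_mull.
  rewrite dvdn_prime2 ?nth_prime_prime // => /eqP.
  by have := nth_prime_ltS n_gt0; lia.
Qed.
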